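(* Let $\Gamma$ be a torsion-free finitely generated nilpotent group with a specified Mal'cev basis $(a_1,\dots,a_m)$, and let $[\sigma]\in H^2(\Gamma)$ be a cohomology class that is skinny with respect to the canonical homomorphism. Let $\sigma$ be a 2-cocycle representative of $[\sigma]$ such that $\sigma(x,y)=q(x_1,\dots,x_m,y_1)$ for all $x,y\in\Gamma$, for some $q\in\mathbb{Q}[x_1,\dots,x_m,y_1]$. Then for every positive integer $n$ coprime to the denominators of the coefficients of $q$, the formula $$\rho_n(x)\delta_{\bar j}=\exp\left(\frac{2\pi i}{n}q(x_1,\dots,x_m,j)\right)\delta_{\bar j+\bar x_1}\qquad(x\in\Gamma,\ j\in\mathbb{Z})$$ gives a well-defined function $\rho_n:\Gamma\to U(\ell^2(\mathbb{Z}/n\mathbb{Z}))$ into the unitary group of $\ell^2(\mathbb{Z}/n\mathbb{Z})$.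
   Context: A Mal'cev basis of a torsion-free finitely generated nilpotent group $\Gamma$ is a tuple $(a_1,\dots,a_m)\in\Gamma^m$ such that every $g\in\Gamma$ can be written uniquely as $g=a_1^{x_1}\cdots a_m^{x_m}$ with $(x_1,\dots,x_m)\in\mathbb{Z}^m$, and the subgroups $\Gamma_i=\langle a_i,\dots,a_m\rangle$ form a central series for $\Gamma$ (i.e. $[\Gamma,\Gamma_i]\subseteq\Gamma_{i+1}$, with $\Gamma_{m+1}=\{e\}$). Elements $x\in\Gamma$ are identified with their exponent tuples $(x_1,\dots,x_m)$. The canonical homomorphism is $\alpha:\Gamma\to\mathbb{Z}$, $\alpha(x)=x_1$. $H^2(\Gamma)$ is group cohomology with trivial coefficients $\mathbb{Z}$; a 2-cocycle is a function $\sigma:\Gamma\times\Gamma\to\mathbb{Z}$ with $\sigma(y,z)-\sigma(xy,z)+\sigma(x,yz)-\sigma(x,y)=0$ for all $x,y,z$. A class in $H^2(\Gamma)$ is skinny with respect to $\alpha\in\operatorname{Hom}(\Gamma,\mathbb{Z})$ if its restriction to $\ker(\alpha)$ is zero in $H^2(\ker(\alpha))$. Every class skinny with respect to the canonical homomorphism has a representative of the polynomial form in the claim. For $j\in\mathbb{Z}$, $\bar j$ is its reduction mod $n$, and $\delta_{\bar j}\in\ell^2(\mathbb{Z}/n\mathbb{Z})$ is the corresponding standard basis vector. *)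

(* Defs.v *)
From HB Require Import structures.
From mathcomp Require Import all_boot all_order all_algebra.
From mathcomp Require Import generic_quotient ring_quotient.
From mathcomp Require Import boolp classical_sets functions reals sequences trigo.
From mathcomp Require Import complex spectral zify.
(* Not imported: the notations of mpoly clash with those of mathcomp-analysis. *)
From mathcomp Require mpoly.

Set Implicit Arguments.
Unset Strict Implicit.
Unset Printing Implicit Defensive.

Import Order.TTheory GRing.Theory Num.Theory.
Local Open Scope classical_set_scope.
Local Open Scope ring_scope.
Local Open Scope quotient_scope.

Section Groups.
Variable G : groupType.
Implicit Types (x y g : G) (A B S : set G).

Definition expgz x (k : int) : G :=
  match k with Posz n => (x ^+ n)%g | Negz n => (x ^- n.+1)%g end.

Definition is_subgroup A : Prop :=
  [/\ A 1%g, forall x y, A x -> A y -> A (x * y)%g & forall x, A x -> A x^-1%g].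

Definition gen S : set G := smallest is_subgroup S.

Definition comm_subgroup A B : set G :=
  gen [set g | exists x y, [/\ A x, B y & g = [~ x, y]%g]].

Fixpoint lower_central (k : nat) : set G :=
  if k is k'.+1 then comm_subgroup setT (lower_central k') else setT.

Definition nilpotent_group : Prop :=
  exists k, lower_central k = [set 1%g].

Definition torsion_free : Prop :=
  forall x (k : nat), (0 < k)%N -> (x ^+ k)%g = 1%g -> x = 1%g.

Definition finitely_generated : Prop :=
  exists s : seq G, gen [set` s] = setT.

End Groups.

Section Malcev.
Variables (G : groupType) (m : nat) (a : m.-tuple G).

(* With [a] written as (a_1, ..., a_m), this is <a_(i+1), ..., a_m>, since
   indices start at 0; it is trivial for [m <= i]. *)
Definition tail_subgroup (i : nat) : set G :=
  gen [set g | exists2 j : 'I_m, (i <= j)%N & g = tnth a j].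

Definition malcev_word (e : {ffun 'I_m -> int}) : G :=
  (\prod_(i < m) expgz (tnth a i) (e i))%g.

Definition malcev_basis : Prop :=
  (forall g, exists! e : {ffun 'I_m -> int}, g = malcev_word e) /\
  (forall i : nat, (i < m)%N ->
     comm_subgroup setT (tail_subgroup i) `<=` tail_subgroup i.+1).

(* The exponent tuple of [g]; the default value is used only when
   [a] is not a Mal'cev basis. *)
Definition malcev_coord (g : G) : {ffun 'I_m -> int} :=
  xget 0 [set e | g = malcev_word e].

End Malcev.

Definition hom_int (G : groupType) : Type :=
  {alpha : G -> int | {morph alpha : x y / (x * y)%g >-> x + y}}.

Section Kernel.
Variables (G : groupType) (alpha : hom_int G).

Definition hom_ker : {pred G} := [pred x | sval alpha x == 0].

Fact hom_int1 : sval alpha 1%g = 0.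
Proof.
by apply: (addrI (sval alpha 1%g)); rewrite -(svalP alpha) mulg1 addr0.
Qed.

Fact hom_ker_closed : group_closed hom_ker.
Proof.
split=> [|x y]; rewrite !inE; first by rewrite hom_int1.
move=> /eqP hx /eqP hy; have := hom_int1.
by rewrite -(mulgV y) !(svalP alpha) hx hy !add0r => ->.
Qed.

Record ker_group := KerGroup { ker_val : G; _ : ker_val \in hom_ker }.

HB.instance Definition _ := [isSub for ker_val].
HB.instance Definition _ := [Choice of ker_group by <:].
HB.instance Definition _ :=
  SubChoice_isSubGroup.Build G hom_ker ker_group hom_ker_closed.

End Kernel.

Section Cohomology.
Variable G : groupType.

Definition cocycle2 : {pred G -> G -> int} :=
  [pred s | `[< forall x y z : G,
     s y z - s (x * y)%g z + s x (y * z)%g - s x y = 0 >]].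

Fact cocycle2_zmod_closed : zmod_closed cocycle2.
Proof.
split=> [|s t]; first by apply/asboolP.
move=> /asboolP hs /asboolP ht; apply/asboolP => x y z.
have := congr2 (fun k l => k - l) (hs x y z) (ht x y z).
change (s y z - s (x * y)%g z + s x (y * z)%g - s x y -
  (t y z - t (x * y)%g z + t x (y * z)%g - t x y) = 0 - 0 ->
  (s y z - t y z) - (s (x * y)%g z - t (x * y)%g z) +
  (s x (y * z)%g - t x (y * z)%g) - (s x y - t x y) = 0); lia.
Qed.
HB.instance Definition _ :=
  GRing.isZmodClosed.Build (G -> G -> int) cocycle2 cocycle2_zmod_closed.

Record Z2 := MkZ2 { cochain :> G -> G -> int; _ : cochain \in cocycle2 }.

HB.instance Definition _ := [isSub for cochain].
HB.instance Definition _ := [Choice of Z2 by <:].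
HB.instance Definition _ := [SubChoice_isSubZmodule of Z2 by <:].

Definition coboundary1 (b : G -> int) (x y : G) : int :=
  b y - b (x * y)%g + b x.

Definition B2 : {pred Z2} :=
  [pred s : Z2 | `[< exists b : G -> int, cochain s = coboundary1 b >]].

Fact B2_zmod_closed : zmod_closed B2.
Proof.
split=> [|s t].
  by apply/asboolP; exists 0; apply/funext => x; apply/funext => y.
move=> /asboolP[b hb] /asboolP[d hd]; apply/asboolP; exists (b - d).
rewrite -[cochain _]/(val _) raddfB /= hb hd.
apply/funext => x; apply/funext => y; rewrite /coboundary1.
change (b y - b (x * y)%g + b x - (d y - d (x * y)%g + d x) =
  (b y - d y) - (b (x * y)%g - d (x * y)%g) + (b x - d x)); lia.
Qed.
HB.instance Definition _ := GRing.isZmodClosed.Build Z2 B2 B2_zmod_closed.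

Definition H2 : zmodType := Quotient.quot B2.

End Cohomology.

Definition coh_class (G : groupType) (s : Z2 G) : H2 G := \pi_(H2 G) s.

Section Restriction.
Variables (G : groupType) (alpha : hom_int G).

Definition res_cochain (s : G -> G -> int) (x y : ker_group alpha) : int :=
  s (val x) (val y).

Fact res_cochain_cocycle (s : Z2 G) : res_cochain s \in @cocycle2 (ker_group alpha).
Proof.
have /asboolP hs : cochain s \in @cocycle2 G by case: s.
by apply/asboolP => x y z; exact: hs.
Qed.

Definition res_Z2 (s : Z2 G) : Z2 (ker_group alpha) :=
  MkZ2 (res_cochain_cocycle s).

Definition res_H2 (c : H2 G) : H2 (ker_group alpha) :=
  coh_class (res_Z2 (repr c)).

(* [res_H2] does not depend on the representative chosen by [repr]. *)
Lemma res_H2_class (s : Z2 G) : res_H2 (coh_class s) = coh_class (res_Z2 s).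
Proof.
apply/eqP; rewrite /res_H2 /coh_class -Quotient.idealrBE.
have : repr (\pi_(H2 G) s) - s \in B2 (G := G).
  by rewrite Quotient.idealrBE reprK.
move=> /asboolP[b hb]; apply/asboolP; exists (b \o val).
apply/funext => x; apply/funext => y.
exact: (congr1 (fun f => f (val x) (val y)) hb).
Qed.

Definition skinny (c : H2 G) : Prop := res_H2 c = 0.

End Restriction.

Section CanonicalHom.
Variables (G : groupType) (m : nat) (a : m.+1.-tuple G).
Hypothesis ha : malcev_basis a.

Let T := tail_subgroup a.
Let b (i : nat) : G := nth 1%g a i.
Let P (i : nat) (e : nat -> int) : G :=
  (\prod_(i <= j < m.+1) expgz (b j) (e j))%g.

Lemma expgzS (x : G) k : expgz x (k + 1) = (expgz x k * x)%g.
Proof.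
case: k => [n|[|n]].
- by rewrite -PoszD addn1 /= expgSr.
- by rewrite /= mulVg.
have -> : Negz n.+1 + 1 = Negz n by lia.
by rewrite /= [(x ^+ n.+2)%g]expgS invgM mulgVK.
Qed.

Lemma expgzP (x : G) k : expgz x (k - 1) = (expgz x k * x^-1)%g.
Proof. by rewrite -[in RHS](subrK 1 k) expgzS mulgK. Qed.

Lemma expgzD (x : G) k l : expgz x (k + l) = (expgz x k * expgz x l)%g.
Proof.
elim: l => [|l IH|l IH]; first by rewrite addr0 mulg1.
- by rewrite -addn1 PoszD addrA expgzS IH expgzS mulgA.
- by rewrite -addn1 PoszD opprD addrA expgzP IH expgzP mulgA.
Qed.

Lemma gen_subgroup (S : set G) : is_subgroup (gen S).
Proof.
split.
- by move=> A [[]].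
- by move=> x y hx hy A hA; case: (hA) => -[_ h _] _; apply: h; [exact: hx|exact: hy].
- by move=> x hx A hA; case: (hA) => -[_ _ h] _; apply: h; exact: hx.
Qed.

Lemma tail_sub i : T i.+1 `<=` T i.
Proof.
apply: smallest_sub; first exact: gen_subgroup.
by move=> g [j hj ->] A [_]; apply; exists j => //; exact: ltnW.
Qed.

Lemma tail_gt i : (m < i)%N -> T i `<=` [set 1%g].
Proof.
move=> hi; apply: smallest_sub.
  by split=> // [x y -> ->|x ->]; rewrite /= ?mulg1 ?invg1.
by move=> g [j hj]; have := ltn_ord j; lia.
Qed.

Lemma tail_comm i x y : (i < m.+1)%N -> T i y -> T i.+1 [~ x, y]%g.
Proof.
move=> hi hy; apply: (ha.2 i hi) => A [_]; apply.
by exists x, y.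
Qed.

Lemma tail_conj i x y : T i y -> T i (y ^ x)%g.
Proof.
move=> hy; case: (ltnP i m.+1) => hi.
  have -> : (y ^ x = y * [~ x, y]^-1)%g.
    by rewrite invgR commgEl mulVKg.
  have [_ hM hV] := gen_subgroup [set g | exists2 j : 'I_m.+1, (i <= j)%N & g = tnth a j].
  by apply: hM => //; apply: hV; apply: tail_sub; exact: tail_comm.
by move: (tail_gt hi hy) => /= ->; rewrite conj1g; case: (gen_subgroup [set g | exists2 j : 'I_m.+1, (i <= j)%N & g = tnth a j]).
Qed.

Lemma mulg_conj4 (x u y v : G) :
  (x * u * (y * v) = x * y * (u ^ y * v))%g.
Proof. by rewrite conjgE !mulgA mulgK. Qed.

Lemma tail_split i g : (i < m.+1)%N -> T i g ->
  exists k h, T i.+1 h /\ g = (expgz (b i) k * h)%g.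
Proof.
move=> hi; have [h1 hM hV] := gen_subgroup [set g | exists2 j : 'I_m.+1, (i.+1 <= j)%N & g = tnth a j].
apply: (@smallest_sub _ _ _ [set g | exists k h, T i.+1 h /\ g = (expgz (b i) k * h)%g]).
  split.
  - by exists 0, 1%g; split; [exact: h1 | rewrite /= mulg1].
  - move=> _ _ [k [u [hu ->]]] [l [v [hv ->]]].
    exists (k + l), (u ^ expgz (b i) l * v)%g; split.
      by apply: hM => //; exact: tail_conj.
    by rewrite expgzD mulg_conj4.
  - move=> _ [k [u [hu ->]]].
    exists (- k), (u^-1 ^ expgz (b i) (- k))%g; split.
      by apply: tail_conj; exact: hV.
    rewrite -conjgC invgM; congr (_ * _)%g.
    by apply: mulg1_eq; rewrite -expgzD subrr.
move=> _ [j hj ->]; case: (ltngtP i j) hj => // [hij _|hij _].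
  exists 0, (tnth a j); split; last by rewrite mul1g.
  by move=> A [_]; apply; exists j.
exists 1, 1%g; split => //.
by rewrite mulg1 /= expg1 /b hij -tnth_nth.
Qed.

Lemma tail_word d i g : (i + d = m.+1)%N -> T i g -> exists e, g = P i e.
Proof.
elim: d i g => [|d IH] i g hid hg.
  exists (fun=> 0); rewrite /P big_geq; last by lia.
  by apply: tail_gt hg; lia.
have hi : (i < m.+1)%N by lia.
have [k [h [hh ->]]] := tail_split hi hg.
have [|e ->] := IH i.+1 h _ hh; first by lia.
exists (fun j => if j == i then k else e j).
rewrite /P [RHS]big_ltn // eqxx; congr (_ * _)%g.
apply: eq_big_nat => j /andP[hij _].
by case: eqP hij => // ->; rewrite ltnn.
Qed.

Lemma malcev_wordE (e : nat -> int) :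
  malcev_word a [ffun i : 'I_m.+1 => e i] = P 0 e.
Proof.
rewrite /malcev_word /P big_mkord; apply: eq_bigr => i _.
by rewrite ffunE /b -tnth_nth.
Qed.

Lemma malcev_coordK g : malcev_word a (malcev_coord a g) = g.
Proof.
have [e [he _]] := ha.1 g.
by symmetry; exact: (@xgetPex _ 0 [set e | g = malcev_word a e] (ex_intro _ e he)).
Qed.

Lemma malcev_coord_word e : malcev_coord a (malcev_word a e) = e.
Proof.
have [f [_ hf]] := ha.1 (malcev_word a e).
exact: etrans (esym (hf _ (esym (malcev_coordK _)))) (hf e erefl).
Qed.

Lemma malcev_head g : exists2 u, T 1 u &
  g = (expgz (b 0) (malcev_coord a g ord0) * u)%g.
Proof.
rewrite -{1}(malcev_coordK g) /malcev_word big_ord_recl.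
exists (\prod_(i < m) expgz (tnth a (lift ord0 i)) (malcev_coord a g (lift ord0 i)))%g.
  have [h1 hM hV] := gen_subgroup [set g | exists2 j : 'I_m.+1, (1 <= j)%N & g = tnth a j].
  elim/big_ind: _ => // i _.
  have ht : T 1 (tnth a (lift ord0 i)).
    by move=> A [_]; apply; exists (lift ord0 i).
  have hX k : T 1 (tnth a (lift ord0 i) ^+ k)%g.
    by elim: k => [|k IH]; rewrite ?expg0 // expgS; exact: hM.
  by case: (malcev_coord _ _ _) => k /=; [exact: hX|apply: hV; exact: hX].
by rewrite (tnth_nth 1%g).
Qed.

Lemma malcev_coord_head k u : T 1 u ->
  malcev_coord a (expgz (b 0) k * u)%g ord0 = k.
Proof.
move=> hu; have [|e ->] := @tail_word m 1 u _ hu; first by lia.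
have -> : (expgz (b 0) k * P 1 e)%g = P 0 (fun j => if j is 0%N then k else e j).
  by rewrite /P [RHS]big_ltn //; congr (_ * _)%g; apply: eq_big_nat => -[].
by rewrite -malcev_wordE malcev_coord_word ffunE.
Qed.

Lemma malcev_coord0M :
  {morph (fun x => malcev_coord a x ord0) : x y / (x * y)%g >-> x + y}.
Proof.
move=> x y /=; have [u hu ex] := malcev_head x; have [v hv ey] := malcev_head y.
have [_ hM _] := gen_subgroup [set g | exists2 j : 'I_m.+1, (1 <= j)%N & g = tnth a j].
move: ex ey; set k := malcev_coord a x ord0; set l := malcev_coord a y ord0.
move=> -> ->.
have -> : (expgz (b 0) k * u * (expgz (b 0) l * v) =
           expgz (b 0) (k + l) * (u ^ expgz (b 0) l * v))%g.
  by rewrite expgzD mulg_conj4.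
by apply: malcev_coord_head; apply: hM => //; exact: tail_conj.
Qed.

Definition canonical_hom : hom_int G :=
  exist _ (fun x => malcev_coord a x ord0) malcev_coord0M.

End CanonicalHom.

(* The first [m] variables are x_1, ..., x_m; the last of the [m.+1] variables is [y_1]. *)
Definition qeval (m : nat) (q : mpoly.mpoly m.+1 rat)
    (x : {ffun 'I_m -> int}) (y : int) : rat :=
  mpoly.meval
    (fun i => if unlift ord_max i is Some j then (x j)%:~R else y%:~R) q.

Definition coprime_denominators (k : nat) (n : nat) (q : mpoly.mpoly k rat) : Prop :=
  forall mon : mpoly.multinom k, coprime n `|denq (mpoly.mcoeff mon q)|%N.

Definition cexp (R : realType) (z : R[i]) : R[i] :=
  (expR (complex.Re z) * cos (complex.Im z) +i*
   (expR (complex.Re z) * sin (complex.Im z)))%C.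

(* Z/n for positive [n = k.+1] is the additive group ['I_k.+1] (this is the
   trivial group when [k = 0], unlike ['Z_1]). *)
Definition int_mod (k : nat) (j : int) : 'I_k.+1 := inZp `|(j %% k.+1%:Z)%Z|%N.

(* Operators on l^2(Z/n) are matrices acting on column vectors. *)
Definition unitary_group (R : realType) (n : nat) : Type :=
  {M : 'M[R[i]]_n | M \is unitarymx}.

Definition delta (R : realType) (k : nat) (i : 'I_k.+1) : 'cV[R[i]]_k.+1 :=
  delta_mx i ord0.

(* Main.v *)
(* Every (x_1, ..., x_m, j) is realised by a pair of group elements, so the
   polynomial q, being a value of sigma there, takes integer values on integer
   points.  If j = l mod n, clearing the denominators of q shows that n divides
   d (q(x, j) - q(x, l)) for some d coprime to n, hence n divides the integer
   q(x, j) - q(x, l), and the phase exp(2 pi i q(x, j) / n) depends only on j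
   mod n.  The operator is then a permutation matrix with unimodular weights. *)
Require Import Defs.
From mathcomp Require Import all_boot all_order all_algebra.
From mathcomp Require Import boolp classical_sets reals trigo complex.
From mathcomp Require Import exp spectral ring.
From mathcomp Require mpoly.

Set Implicit Arguments.
Unset Strict Implicit.
Unset Printing Implicit Defensive.

Import Order.TTheory GRing.Theory Num.Theory.
Local Open Scope ring_scope.

Lemma prod_expz_congr (I : Type) (r : seq I) (N : int) (u v : I -> int)
    (e : I -> nat) :
  (forall i, (N %| u i - v i)%Z) ->
  (N %| \prod_(i <- r) u i ^+ e i - \prod_(i <- r) v i ^+ e i)%Z.
Proof.
move=> uv; elim/big_ind2: _ => [|x2 x1 y2 y1 hx hy|i _].
- by rewrite subrr dvdz0.
- have -> : x1 * y1 - x2 * y2 = (x1 - x2) * y1 + x2 * (y1 - y2) by ring.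
  by apply: rpredD; [exact: dvdz_mulr | exact: dvdz_mull].
- by rewrite subrXX dvdz_mulr.
Qed.

Lemma meval_intrE (k : nat) (q : mpoly.mpoly k rat) (u : 'I_k -> int) :
  mpoly.meval (fun i => (u i)%:~R) q =
  \sum_(mon <- mpoly.msupp q) mpoly.mcoeff mon q *
    (\prod_i u i ^+ mpoly.fun_of_multinom mon i)%:~R.
Proof.
rewrite mpoly.mevalE; apply: eq_bigr => mon _; congr (_ * _).
by rewrite rmorph_prod; apply: eq_bigr => i _; rewrite rmorphXn.
Qed.

(** The two values are only rational, so the congruence is stated after scaling by some [d]. Going
    through the sum over monomials, [d] accumulates as the product of the coefficients'
    denominators, each coprime to [n]. *)
Lemma meval_intr_congr (k n : nat) (q : mpoly.mpoly k rat) (u v : 'I_k -> int) :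
  coprime_denominators n q -> (forall i, (n%:Z %| u i - v i)%Z) ->
  exists d z : int, coprimez n d /\
    d%:~R * (mpoly.meval (fun i => (u i)%:~R) q -
             mpoly.meval (fun i => (v i)%:~R) q) = (n%:Z * z)%:~R.
Proof.
move=> hq uv; rewrite !meval_intrE -sumrB.
elim/big_ind: _ => [|x y [d1 [z1 [c1 e1]]] [d2 [z2 [c2 e2]]]|mon _].
- by exists 1, 0; rewrite coprimezE coprimen1 !mulr0.
- exists (d1 * d2), (d2 * z1 + d1 * z2); split; first by rewrite coprimezMr c1.
  have -> : (d1 * d2)%:~R * (x + y) = d2%:~R * (d1%:~R * x) + d1%:~R * (d2%:~R * y).
    by rewrite intrM; ring.
  by rewrite e1 e2 -!intrM -intrD; congr (_%:~R); ring.
- have /dvdzP[z ez] := prod_expz_congr (index_enum _) (mpoly.fun_of_multinom mon) uv.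
  exists (denq (mpoly.mcoeff mon q)), (numq (mpoly.mcoeff mon q) * z); split.
    by rewrite coprimezE; exact: hq.
  by rewrite -mulrBr -intrB ez !intrM numqE; ring.
Qed.

(** Once both values are integers, the previous relation holds in the integers and Gauss's lemma
    cancels [d]. *)
Lemma meval_int_congr (k n : nat) (q : mpoly.mpoly k rat) (u v : 'I_k -> int)
    (s t : int) :
  coprime_denominators n q -> (forall i, (n%:Z %| u i - v i)%Z) ->
  s%:~R = mpoly.meval (fun i => (u i)%:~R) q ->
  t%:~R = mpoly.meval (fun i => (v i)%:~R) q ->
  (n%:Z %| s - t)%Z.
Proof.
move=> hq uv es et; have [d [z [cd]]] := meval_intr_congr hq uv.
rewrite -es -et -intrB -intrM => /intr_inj e.
by rewrite -(Gauss_dvdzr _ cd) e dvdz_mulr.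
Qed.

Lemma qeval_int_congr (m n : nat) (q : mpoly.mpoly m.+1 rat)
    (x : {ffun 'I_m -> int}) (j l s t : int) :
  coprime_denominators n q -> (n%:Z %| j - l)%Z ->
  s%:~R = qeval q x j -> t%:~R = qeval q x l -> (n%:Z %| s - t)%Z.
Proof.
(* Moving the cast out of the case distinction exhibits the evaluation point as an integer
   vector. *)
have qE y : qeval q x y = mpoly.meval
    (fun i => (if unlift ord_max i is Some h then x h else y)%:~R) q.
  by congr (mpoly.meval _ q); apply/funext => i; case: unlift.
move=> hq jl; rewrite !qE; apply: meval_int_congr => // i.
by case: unlift => [h|//]; rewrite subrr dvdz0.
Qed.

Section RootsOfUnity.
Variables (R : realType) (n : nat).

Lemma cexp_imaginary (t : R) : cexp (0 +i* t)%C = (cos t +i* sin t)%C.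
Proof. by rewrite /cexp /= expR0 !mul1r. Qed.

Lemma root_of_unityE (z : int) :
  cexp ((2 * pi)%:C * 'i / n.+1%:R * z%:~R)%C =
  (cos (2 * pi * z%:~R / n.+1%:R) +i* sin (2 * pi * z%:~R / n.+1%:R))%C :> R[i].
Proof.
rewrite -cexp_imaginary; congr cexp.
have -> : (0 +i* (2 * pi * z%:~R / n.+1%:R))%C =
    (2 * pi * z%:~R / n.+1%:R)%:C%C * 'i%C :> R[i].
  by simpc.
rewrite -complexiE !rmorphM fmorphV !rmorph_nat rmorph_int /=; ring.
Qed.

Lemma cos_sin_periodicz (t : R) (k : int) :
  cos (t + pi *+ 2 *~ k) = cos t /\ sin (t + pi *+ 2 *~ k) = sin t.
Proof.
have hn (s : R) m : cos (s + pi *+ 2 *+ m) = cos s /\ sin (s + pi *+ 2 *+ m) = sin s.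
  by rewrite (periodicn (@cosD2pi R)) (periodicn (@sinD2pi R)).
case: k => m; first exact: hn.
rewrite NegzE mulrNz -pmulrn.
(* A negative multiple reduces to a natural one based at the shifted point. *)
have [<- <-] := hn (t - pi *+ 2 *+ m.+1) m.+1.
by rewrite subrK.
Qed.

Lemma root_of_unity_congr (z w : int) : (n.+1%:Z %| z - w)%Z ->
  cexp ((2 * pi)%:C * 'i / n.+1%:R * z%:~R)%C =
  cexp ((2 * pi)%:C * 'i / n.+1%:R * w%:~R)%C :> R[i].
Proof.
move=> /dvdzP[k /eqP]; rewrite subr_eq => /eqP ->.
rewrite !root_of_unityE.
have -> : 2 * pi * (k * n.+1%:Z + w)%:~R / n.+1%:R =
    2 * pi * w%:~R / n.+1%:R + pi *+ 2 *~ k :> R.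
  rewrite intrD intrM -[_ *~ k]mulrzr -mulr_natl.
  by field; rewrite nat1r pnatr_eq0.
by have [-> ->] := cos_sin_periodicz (2 * pi * w%:~R / n.+1%:R) k.
Qed.

Lemma root_of_unity_mulJ (z : int) :
  (cexp ((2 * pi)%:C * 'i / n.+1%:R * z%:~R)%C : R[i])^* *
  cexp ((2 * pi)%:C * 'i / n.+1%:R * z%:~R)%C = 1.
Proof.
rewrite root_of_unityE; set t := (_ / _).
have -> (x y : R) : ((x +i* y)%C : R[i])^* = (x -i* y)%C by [].
apply/eqP; rewrite eq_complex /=; apply/andP; split; apply/eqP; last by ring.
by rewrite mulNr opprK -!expr2 cos2Dsin2.
Qed.

End RootsOfUnity.

Section WeightedPermutation.
Variables (C : numClosedFieldType) (n : nat) (s : 'I_n -> 'I_n) (f : 'I_n -> C).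

Definition wperm_mx : 'M[C]_n := \matrix_(i, j) (if i == s j then f j else 0).

Lemma wperm_mx_delta (j : 'I_n) :
  wperm_mx *m delta_mx j (@ord0 0) = f j *: delta_mx (s j) (@ord0 0).
Proof.
rewrite -colE; apply/matrixP => i k; rewrite !mxE [k]ord1 eqxx andbT.
by case: eqP; rewrite ?mulr1 ?mulr0.
Qed.

(** Passing to the conjugate transpose turns the goal into orthonormality of the columns. Column [i]
    has its only possibly nonzero entry in row [s i], so injectivity of [s] makes distinct columns
    orthogonal. *)
Lemma wperm_mx_unitary : injective s -> (forall j, (f j)^* * f j = 1) ->
  wperm_mx \is unitarymx.
Proof.
move=> s_inj f1; rewrite -trmxC_unitary; apply/unitarymxP.
have -> : map_mx Num.conj (map_mx Num.conj wperm_mx^T)^T = wperm_mx.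
  by apply/matrixP => i j; rewrite !mxE conjCK.
apply/matrixP => i j; rewrite !mxE (bigD1 (s i)) //= !mxE eqxx (inj_eq s_inj).
rewrite big1 ?addr0 => [|k /negPf ki]; last by rewrite !mxE ki rmorph0 mul0r.
by case: eqP => [<-|_]; rewrite ?f1 ?mulr0.
Qed.

End WeightedPermutation.

Lemma eq_mulmx_delta (A : pzSemiRingType) (m n : nat) (M M' : 'M[A]_(m, n)) :
  (forall j, M *m delta_mx j (@ord0 0) = M' *m delta_mx j ord0) -> M = M'.
Proof.
move=> h; apply/matrixP => i j.
by have := congr1 (fun c : 'cV_m => c i 0) (h j); rewrite -!colE !mxE.
Qed.

Lemma int_mod_ord (n : nat) (i : 'I_n.+1) : int_mod n i = i.
Proof.
apply/val_inj; rewrite /int_mod /= modz_nat /=.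
by rewrite !modn_small // ltn_mod.
Qed.

Lemma int_mod_congr (n : nat) (j : int) :
  (n.+1%:Z %| (int_mod n j : nat)%:Z - j)%Z.
Proof.
rewrite -eqz_mod_dvd /int_mod /=.
have h : (j %% n.+1%:Z)%Z = `|(j %% n.+1%:Z)%Z|%N by rewrite gez0_abs ?modz_ge0.
by rewrite -modz_nat -h !modz_mod.
Qed.

(** Well-definedness is rendered as unique existence: the formula is imposed for all integers [j],
    so existence includes independence of the representative of [j] modulo [n.+1]. *)
Theorem proposition4p1 (R : realType) (Gamma : groupType) (m : nat)
  (Gamma_tf : torsion_free Gamma)
  (Gamma_fg : finitely_generated Gamma)
  (Gamma_nil : nilpotent_group Gamma)
  (a : m.+1.-tuple Gamma) (ha : malcev_basis a)
  (c : H2 Gamma) (c_skinny : skinny (canonical_hom ha) c)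
  (sigma : Z2 Gamma) (sigma_c : coh_class sigma = c)
  (q : mpoly.mpoly m.+2 rat)
  (sigma_q : forall x y : Gamma,
     (sigma x y)%:~R = qeval q (malcev_coord a x) (malcev_coord a y ord0))
  (n : nat) (n_coprime : coprime_denominators n.+1 q) :
  exists! rho : Gamma -> unitary_group R n.+1,
    forall (x : Gamma) (j : int),
      val (rho x) *m delta R (int_mod n j) =
        cexp ((2 * pi)%:C * 'i / n.+1%:R * ratr (qeval q (malcev_coord a x) j))%C
          *: delta R (int_mod n j + int_mod n (malcev_coord a x ord0)).
Proof.
(* All exponents of [pw j] equal [j]; only the first one matters, and it makes [sigma x (pw j)] an
   integer equal to the value of [q] at [x] and [j]. *)
pose pw (j : int) := malcev_word a [ffun=> j].
have qE x j : (sigma x (pw j))%:~R = qeval q (malcev_coord a x) j.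
  by rewrite sigma_q malcev_coord_word // ffunE.
(* The weight is read off at the representative of the class between 0 and [n]. *)
pose w x (j : 'I_n.+1) : R[i] :=
  cexp ((2 * pi)%:C * 'i / n.+1%:R * (sigma x (pw j))%:~R)%C.
pose s x (j : 'I_n.+1) := j + int_mod n (malcev_coord a x ord0).
have M_unitary x : wperm_mx (s x) (w x) \is unitarymx.
  apply: wperm_mx_unitary => [|j]; first exact: addIr.
  exact: root_of_unity_mulJ.
exists (fun x => exist _ (wperm_mx (s x) (w x)) (M_unitary x)).
split=> [x j|rho hrho].
  rewrite /= wperm_mx_delta; congr (_ *: _).
  (* It remains to compare the phases at [j] and at its representative, which differ by a multiple
     of [n.+1]. *)
  rewrite -qE ratr_int; apply: root_of_unity_congr.
  exact: qeval_int_congr n_coprime (int_mod_congr n j) (qE _ _) (qE _ _).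
(* Each index is the class of itself as an integer, so the formula prescribes every column of
   [rho x]. *)
apply/funext => x; apply/val_inj/eq_mulmx_delta => j /=.
have := hrho x j; rewrite /delta int_mod_ord => ->.
by rewrite wperm_mx_delta -qE ratr_int.
Qed.
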